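(* Let $m,\alpha$ be positive integers, let $\rho$ be a polynomial unitary representation of $\mathrm{U}(\alpha)$, and let $F\in \mathrm{Char}(m,\alpha)$. Then $\rho\circ F$ belongs to $\mathrm{Char}(m,\dim\rho)$.
   Context: $\mathrm{U}(n)$ is the group of unitary $n\times n$ matrices and $1_n$ the unit matrix of order $n$. $\mathrm{B}_n$ is the set of complex $n\times n$ matrices $z$ with Euclidean operator norm $\|z\|<1$, and $\overline{\mathrm{B}}_n$ is the set of those with $\|z\|\le 1$. Characteristic functions: for an integer $j\ge 0$, let $g=\begin{pmatrix}a&b\\c&d\end{pmatrix}\in \mathrm{U}(\alpha+mj)$, with $a$ of size $\alpha\times\alpha$ and $d$ of size $mj\times mj$. For $S=(s_{\mu\nu})\in \mathrm{B}_m$ let $1_j\otimes S$ denote the $mj\times mj$ block matrix with $m\times m$ blocks, whose $(\mu,\nu)$ block is $s_{\mu\nu}1_j$. Put $$\Theta[g;S]=a+b\,(1_j\otimes S)\bigl(1_{mj}-d\,(1_j\otimes S)\bigr)^{-1}c ,$$ which takes values in $\overline{\mathrm{B}}_\alpha$. $\mathrm{Char}(m,\alpha)$ is the set of all functions $S\mapsto \Theta[g;S]$ on $\mathrm{B}_m$, where $g\in \mathrm{U}(\alpha+mj)$ and $j=0,1,2,\dots$. Polynomial representations: a finite-dimensional (continuous) unitary representation $\rho$ of $\mathrm{U}(\alpha)$ extends uniquely to a holomorphic representation of $\mathrm{GL}(\alpha,\mathbb{C})$. It is called polynomial if all matrix elements of $\rho(g)$ are polynomials in the matrix elements of $g\in\mathrm{GL}(\alpha,\mathbb{C})$.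 In that case the same polynomials extend $\rho$ to the multiplicative semigroup of all $\alpha\times\alpha$ complex matrices, and $\rho\circ F$ means $S\mapsto\rho(F(S))$ for this extension, with operators $\rho(\cdot)$ written as matrices in an orthonormal basis of the representation space. *)

(* Defs.v *)
From HB Require Import structures.
From mathcomp Require Import all_boot all_order all_algebra.
From mathcomp Require Import boolp classical_sets reals topology normedtype derive.
From mathcomp Require Import complex mxtens.
From mathcomp Require mpoly.
Set Implicit Arguments.
Unset Strict Implicit.
Unset Printing Implicit Defensive.
Import Order.TTheory GRing.Theory Num.Theory.
Import numFieldNormedType.Exports.
Local Open Scope classical_set_scope.
Local Open Scope complex_scope.
Local Open Scope ring_scope.

(* The library equips abstract numeric fields with their norm topology, but
   not the concrete type [R[i]]. *)
HB.instance Definition _ (R : rcfType) := NormedModule.copy R[i] R[i]^o.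

Definition enorm (R : realType) (n : nat) (v : 'cV[R[i]]_n) : R :=
  Num.sqrt (\sum_(k < n) Normc.normc (v k 0) ^+ 2).

Definition opnorm (R : realType) (n : nat) (z : 'M[R[i]]_n) : R :=
  sup [set enorm (z *m v) | v in [set v : 'cV[R[i]]_n | enorm v <= 1]].

Definition openB (R : realType) (n : nat) : set 'M[R[i]]_n :=
  [set z | opnorm z < 1].

(* [tensmx S 1%:M] is the m x m block matrix whose (mu, nu) block is the
   j x j matrix [(S mu nu)%:M]; for [S] in [openB] the inverted matrix is
   invertible, so the default value of [invmx] plays no role there. *)
Definition Theta (R : realType) (m alpha j : nat)
    (g : 'M[R[i]]_(alpha + m * j)) (S : 'M[R[i]]_m) : 'M[R[i]]_alpha :=
  let T : 'M[R[i]]_(m * j) := tensmx S (1%:M : 'M_j) in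
  ulsubmx g + ursubmx g *m T *m invmx (1%:M - drsubmx g *m T) *m dlsubmx g.

(* A function on [openB] is represented by a total function on matrices, of
   which only the restriction to [openB] is constrained. *)
Definition Char (R : realType) (m alpha : nat) :
    set ('M[R[i]]_m -> 'M[R[i]]_alpha) :=
  [set F | exists j : nat, exists2 g : 'M[R[i]]_(alpha + m * j),
     g \is unitarymx & forall S, openB S -> F S = Theta g S].

(* Continuous unitary representations of U(alpha) on C^N with its standard
   hermitian structure; values of [rho] outside U(alpha) are irrelevant. *)
Definition unitary_rep (R : realType) (alpha N : nat)
    (rho : 'M[R[i]]_alpha -> 'M[R[i]]_N) : Prop :=
  [/\ rho 1%:M = 1%:M,
      {in unitarymx &, forall g h, rho (g *m h) = rho g *m rho h},
      {in unitarymx, forall g, rho g \is unitarymx} &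
      {within [set g | g \is unitarymx], continuous rho}].

(* Holomorphic representations of GL(alpha, C): [differentiable] is Frechet
   differentiability over the scalar field R[i], i.e. complex one. *)
Definition holomorphic_rep (R : realType) (alpha N : nat)
    (sigma : 'M[R[i]]_alpha -> 'M[R[i]]_N) : Prop :=
  [/\ sigma 1%:M = 1%:M,
      {in unitmx &, forall g h, sigma (g *m h) = sigma g *m sigma h} &
      {in unitmx, forall g, differentiable sigma g}].

(* [P] is a matrix of polynomials in the alpha * alpha matrix elements. *)
Definition poly_eval (R : realType) (alpha N : nat)
    (P : 'M[mpoly.mpoly (alpha * alpha) R[i]]_N) (z : 'M[R[i]]_alpha) :
    'M[R[i]]_N :=
  \matrix_(k, l) mpoly.meval (fun t => mxvec z 0 t) (P k l).

(* The holomorphic extension of [rho] to GL(alpha, C) is polynomial, with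
   matrix elements [P]; [poly_eval P] is then the extension of [rho] to the
   semigroup of all matrices. *)
Definition polynomial_rep (R : realType) (alpha N : nat)
    (rho : 'M[R[i]]_alpha -> 'M[R[i]]_N)
    (P : 'M[mpoly.mpoly (alpha * alpha) R[i]]_N) : Prop :=
  exists sigma : 'M[R[i]]_alpha -> 'M[R[i]]_N,
    [/\ holomorphic_rep sigma,
        {in unitarymx, forall g, sigma g = rho g} &
        {in unitmx, forall g, sigma g = poly_eval P g}].

(* Main.v *)
Require Import Defs.
From mathcomp Require Import all_boot all_order all_algebra.
From mathcomp Require Import boolp classical_sets reals topology normedtype derive.
From mathcomp Require Import complex mxtens.
From mathcomp Require mpoly.
Import (canonicals, coercions) mpoly.
From mathcomp Require Import ring.

Set Implicit Arguments.
Unset Strict Implicit.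
Unset Printing Implicit Defensive.
Import Order.TTheory GRing.Theory Num.Theory.
Local Open Scope classical_set_scope.
Local Open Scope complex_scope.
Local Open Scope ring_scope.
Local Open Scope sesquilinear_scope.

(** The idea is to characterize Char by a kernel identity that is stable under
composition, and to find that identity for a polynomial representation.

A function F on the ball is a characteristic function exactly when
  1 - F(S)^* F(S') = sum_t H_t(S)^* (1 - S^* S') H_t(S')
for finitely many matrix functions H_t.  If F = Theta[g; .], the H_t are the
slices of the internal state (1 - d T)^-1 c, and the identity says that g
preserves inner products (transfer_agler).  Conversely the identity says that
the vectors (x, T H(S) x) and (F(S) x, H(S) x) have the same Gram matrix, so
that some unitary matrix carries the former to the latter; its blocks realize
F (agler_transfer, the lurking isometry argument).  Such kernels form a cone
stable under congruence, hence the identities for F with respect to S and for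
rho with respect to its argument compose (agler_trans).  The theorem is thus
reduced to the case where F is the identity: to
  1 - rho(A)^* rho(B) = sum_t L_t(A)^* (1 - A^* B) L_t(B)
for all matrices A and B (agler_pev).

For a tensor power of the defining representation this is a telescoping sum.
An arbitrary polynomial rho is handled without decomposing it: its matrix
elements live in the space of polynomials on matrices, on which matrices act by
right translation.  The graded pieces of the Fischer inner product,
<p, q>_d = sum over the d-fold iterated partials D of conj(Dp(0)) Dq(0),
satisfy the telescoping identity, by induction on d and the chain rule
(agler_fischer_rtrans).  Summed over the entries of rho, they yield a positive
definite matrix M such that M - rho(A)^* M rho(B) is a kernel of the required
form.  Specializing to A = B unitary shows that M commutes with rho(U(n)), and
conjugating by M^(-1/2) replaces M by 1.

All polynomial identities known on the unitary group are transported to all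
matrices by the unitary trick line_poly_unitary_eq0. *)

(** * Polynomial functions vanishing on the unitary group *)

Section UnitaryDensity.
Variable C : numClosedFieldType.

Lemma adjmx_mul m n p (A : 'M[C]_(m, n)) (B : 'M_(n, p)) :
  (A *m B)^t* = B^t* *m A^t*.
Proof. by rewrite trmx_mul map_mxM. Qed.

Lemma adjmxE m n (A : 'M[C]_(m, n)) i j : A^t* i j = (A j i)^*.
Proof. by rewrite !mxE. Qed.

Lemma unitarymx_mulVl n (u : 'M[C]_n) : u \is unitarymx -> u^t* *m u = 1%:M.
Proof. by move=> uU; rewrite -invmx_unitary // mulVmx // unitarymx_unit. Qed.

(** The Cayley transforms (k + i) / (k - i) of the natural numbers are infinitely
many points of the unit circle. *)
Lemma polyC_unit_circle_eq0 (q : {poly C}) :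
  (forall t, t * t^* = 1 -> q.[t] = 0) -> q = 0.
Proof.
move=> q0; pose w k : C := (k%:R + 'i) / (k%:R - 'i).
have ii : 'i * 'i = -1 :> C by rewrite -expr2 sqrCi.
have nzM k : (k%:R - 'i) * (k%:R + 'i) != 0 :> C.
  have -> : (k%:R - 'i) * (k%:R + 'i) = (k * k)%:R + 1 :> C.
    by rewrite natrM; ring: ii.
  by rewrite natr1 pnatr_eq0.
have nz k : k%:R - 'i != 0 :> C.
  by apply: contraNneq (nzM k) => ->; rewrite mul0r.
have nz' k : k%:R + 'i != 0 :> C.
  by apply: contraNneq (nzM k) => ->; rewrite mulr0.
apply/eqP/contraT => qn0.
have := max_poly_roots qn0 (rs := [seq w k | k <- iota 0 (size q)]).
rewrite size_map size_iota ltnn => -> //.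
  apply/allP => _ /mapP[k _ ->]; apply/eqP/q0.
  rewrite /w rmorphM fmorphV rmorphD rmorphB /= conjC_nat conjCi opprK.
  by field; rewrite nz nz'.
rewrite map_inj_uniq ?iota_uniq // => k l /eqP.
rewrite /w eqr_div // => /eqP e.
have /eqP : ('i *+ 2) * (k%:R - l%:R) = 0 :> C.
  transitivity ((l%:R + 'i) * (k%:R - 'i) - (k%:R + 'i) * (l%:R - 'i) : C).
    by ring.
  by rewrite e subrr.
rewrite mulf_eq0 mulrn_eq0 /= (negbTE (neq0Ci C)) /= subr_eq0 eqr_nat.
by move/eqP.
Qed.

(** Diagonalize A^* A = v^* X v by a unitary matrix; then d = sqrt X, and
u = A v^* X^(-1/2) is unitary. *)
Lemma svd_unitmx n (A : 'M[C]_n) : A \in unitmx ->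
  exists u v (d : 'rV_n),
    [/\ u \is unitarymx, v \is unitarymx & A = u *m diag_mx d *m v].
Proof.
move=> Au; pose M := A^t* *m A.
have Mh : M \is hermsymmx.
  by apply/is_hermitianmxP; rewrite expr0 scale1r adjmx_mul trmxCK.
have /hermitian_normalmx/orthomx_spectralP := Mh.
set V := spectralmx M; set X := spectral_diag M.
have Vu : V \is unitarymx by apply: spectral_unitarymx.
rewrite invmx_unitary // => MV.
pose B := A *m V^t*.
have BB : B^t* *m B = diag_mx X.
  rewrite adjmx_mul trmxCK -mulmxA (mulmxA (A^t*)) -/M MV !mulmxA.
  move/unitarymxP: (Vu) => ->; rewrite mul1mx -mulmxA.
  by move/unitarymxP: (Vu) => ->; rewrite mulmx1.
have X0 i : 0 <= X 0 i.
  have /matrixP/(_ i i) := BB; rewrite !mxE eqxx mulr1n => <-.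
  by apply: sumr_ge0 => k _; rewrite adjmxE mulrC mul_conjC_ge0.
have Xn0 i : X 0 i != 0.
  have : diag_mx X \in unitmx.
    rewrite -BB unitmx_mul; apply/andP; split; last first.
      by rewrite unitmx_mul Au unitarymx_unit // trmxC_unitary.
    by rewrite adjmx_mul trmxCK unitmx_mul unitarymx_unit // map_unitmx unitmx_tr.
  rewrite unitmxE det_diag unitfE; apply: contraNneq => Xi0.
  by rewrite (bigD1 i) //= Xi0 mul0r.
pose d : 'rV_n := \row_i sqrtC (X 0 i).
pose e : 'rV_n := \row_i (sqrtC (X 0 i))^-1.
have ed : diag_mx e *m diag_mx d = 1%:M.
  apply/matrixP => i j; rewrite mul_diag_mx !mxE.
  case: (eqVneq i j) => [_|_]; last by rewrite mulr0n mulr0.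
  by rewrite !mulr1n mulVf // sqrtC_eq0.
have ee : (diag_mx e)^t* = diag_mx e.
  rewrite tr_diag_mx map_diag_mx; congr diag_mx; apply/rowP => i.
  by rewrite !mxE fmorphV; congr (_^-1); apply: CrealP; rewrite ger0_real ?sqrtC_ge0.
exists (B *m diag_mx e), V, d; split => //.
- rewrite -trmxC_unitary; apply/unitarymxP; rewrite trmxCK adjmx_mul ee.
  rewrite -mulmxA (mulmxA (B^t*)) BB.
  apply/matrixP => i j; rewrite mul_diag_mx mul_mx_diag !mxE.
  case: (eqVneq i j) => [<-|_]; last by rewrite !mulr0n !(mulr0, mul0r).
  rewrite !mulr1n -[X in _ * (X * _)](sqrtCK (X 0 i)) expr2.
  by field; rewrite sqrtC_eq0.
- by rewrite -(mulmxA B) ed mulmx1 /B -mulmxA unitarymx_mulVl // mulmx1.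
Qed.

(** Being polynomial along every affine line is all that the unitary trick needs;
it follows from being polynomial, and is obviously stable under left and right
translations. *)
Definition line_poly n (f : 'M[C]_n -> C) :=
  forall A B, exists q : {poly C}, forall t, f (A + t *: B) = q.[t].

Lemma line_poly_const n c : @line_poly n (fun=> c).
Proof. by move=> A B; exists c%:P => t; rewrite hornerC. Qed.

Lemma line_poly_entry n i j : @line_poly n (fun g => g i j).
Proof.
move=> A B; exists ((A i j)%:P + (B i j) *: 'X) => t.
by rewrite !mxE !hornerE mulrC.
Qed.

Lemma line_polyM n (f g : 'M[C]_n -> C) :
  line_poly f -> line_poly g -> line_poly (fun A => f A * g A).
Proof.
move=> lf lg A B; have [p fp] := lf A B; have [q gq] := lg A B.
by exists (p * q) => t; rewrite hornerM fp gq.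
Qed.

Lemma line_polyB n (f g : 'M[C]_n -> C) :
  line_poly f -> line_poly g -> line_poly (fun A => f A - g A).
Proof.
move=> lf lg A B; have [p fp] := lf A B; have [q gq] := lg A B.
by exists (p - q) => t; rewrite hornerD hornerN fp gq.
Qed.

Lemma line_poly_sum n I (r : seq I) (f : I -> 'M[C]_n -> C) :
  (forall i, line_poly (f i)) -> line_poly (fun A => \sum_(i <- r) f i A).
Proof.
move=> lf; elim: r => [|i r IHr] A B.
  by exists 0 => t; rewrite big_nil horner0.
have [p fp] := lf i A B; have [q gq] := IHr A B.
by exists (p + q) => t; rewrite big_cons hornerD fp gq.
Qed.

Lemma line_poly_prod n I (r : seq I) (f : I -> 'M[C]_n -> C) :
  (forall i, line_poly (f i)) -> line_poly (fun A => \prod_(i <- r) f i A).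
Proof.
move=> lf; elim: r => [|i r IHr] A B.
  by exists 1 => t; rewrite big_nil hornerC.
have [p fp] := lf i A B; have [q gq] := IHr A B.
by exists (p * q) => t; rewrite big_cons hornerM fp gq.
Qed.

Lemma line_poly_mulmx n a b c (F : 'M[C]_n -> 'M[C]_(a, b)) (G : 'M_n -> 'M_(b, c)) k l :
  (forall i j, line_poly (fun g => F g i j)) ->
  (forall i j, line_poly (fun g => G g i j)) ->
  line_poly (fun g => (F g *m G g) k l).
Proof.
move=> lF lG A B.
have [q qE] := line_poly_sum (index_enum _) (fun s => line_polyM (lF k s) (lG s l)) A B.
by exists q => t; rewrite mxE qE.
Qed.

Lemma line_poly_mulmxr n (h : 'M[C]_n) f :
  line_poly f -> line_poly (fun g => f (g *m h)).
Proof.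
move=> lf A B; have [q fq] := lf (A *m h) (B *m h).
by exists q => t; rewrite mulmxDl -scalemxAl fq.
Qed.

Lemma line_poly_mulmxl n (h : 'M[C]_n) f :
  line_poly f -> line_poly (fun g => f (h *m g)).
Proof.
move=> lf A B; have [q fq] := lf (h *m A) (h *m B).
by exists q => t; rewrite mulmxDr -scalemxAr fq.
Qed.

Lemma line_poly_det n : line_poly (fun g : 'M[C]_n => \det g).
Proof.
apply: line_poly_sum => s; apply: line_polyM; first exact: line_poly_const.
by apply: line_poly_prod => i; apply: line_poly_entry.
Qed.

(** On the line from the identity to g the determinant is a nonzero polynomial,
since its value at the identity is 1, and its product with f vanishes. *)
Lemma line_poly_unitmx_eq0 n (f : 'M[C]_n -> C) : line_poly f ->
  (forall g, g \in unitmx -> f g = 0) -> forall g, f g = 0.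
Proof.
move=> lf f0 g.
have [p fp] := lf 1%:M (g - 1%:M); have [d dE] := line_poly_det 1%:M (g - 1%:M).
have dn0 : d != 0.
  apply: contra_eq_neq (dE 0) => ->; rewrite scale0r addr0 det1 horner0.
  exact: oner_neq0.
have pd0 : p * d = 0.
  apply: polyC_unit_circle_eq0 => t _; rewrite hornerM -fp -dE.
  have [u|nu] := boolP (1%:M + t *: (g - 1%:M) \in unitmx).
    by rewrite f0 ?mul0r.
  by move: nu; rewrite unitmxE unitfE negbK => /eqP ->; rewrite mulr0.
have /eqP p0 : p == 0.
  by move/eqP: pd0; rewrite mulf_eq0 (negbTE dn0) orbF.
by have := fp 1; rewrite scale1r addrC subrK => ->; rewrite p0 horner0.
Qed.

(** The diagonal entries are freed from the unit circle one at a time. *)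
Lemma line_poly_torus_eq0 n (f : 'M[C]_n -> C) (u v : 'M[C]_n) : line_poly f ->
  (forall d : 'rV_n, (forall i, d 0 i * (d 0 i)^* = 1) ->
     f (u *m diag_mx d *m v) = 0) ->
  forall d, f (u *m diag_mx d *m v) = 0.
Proof.
move=> lf f0.
suff H k (d : 'rV_n) :
    (forall i : 'I_n, (k <= i)%N -> d 0 i * (d 0 i)^* = 1) ->
    f (u *m diag_mx d *m v) = 0.
  by move=> d; apply: (H n) => i; rewrite leqNgt ltn_ord.
elim: k d => [|k IHk] d dU; first by apply: f0 => i; apply: dU.
have [kn|kn] := ltnP k n; last first.
  by apply: IHk => i /(leq_trans kn); rewrite leqNgt ltn_ord.
pose i0 := Ordinal kn; pose e : 'rV[C]_n := delta_mx 0 i0.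
pose d0 := d - d 0 i0 *: e.
have [q fq] := lf (u *m diag_mx d0 *m v) (u *m diag_mx e *m v).
have fE t : f (u *m diag_mx (d0 + t *: e) *m v) = q.[t].
  rewrite -fq; congr (f _).
  by rewrite linearD linearZ mulmxDr mulmxDl -scalemxAr -scalemxAl.
have q0 : q = 0.
  apply: polyC_unit_circle_eq0 => t tU; rewrite -fE; apply: IHk => i ki.
  rewrite !mxE eqxx /=; have [->|ne] := eqVneq i i0.
    by rewrite !mulr1 subrr add0r.
  rewrite !mulr0 subr0 addr0; apply: dU; rewrite ltn_neqAle ki andbT.
  by apply: contra_neq ne => ek; apply: val_inj.
by have := fE (d 0 i0); rewrite subrK => ->; rewrite q0 horner0.
Qed.

(** Unitary trick: by the singular value decomposition an invertible matrix lies
in a complexified torus u T v, where it suffices to know f on the compact torus,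
which consists of unitary matrices. *)
Lemma line_poly_unitary_eq0 n (f : 'M[C]_n -> C) : line_poly f ->
  (forall g, g \is unitarymx -> f g = 0) -> forall g, f g = 0.
Proof.
move=> lf f0; apply: line_poly_unitmx_eq0 => // g /svd_unitmx[u [v [d [uU vU ->]]]].
apply: line_poly_torus_eq0 => // {}d dU; apply: f0.
do 2?[apply: mul_unitarymx => //]; apply/unitarymxP.
rewrite tr_diag_mx map_diag_mx mulmx_diag -diag_const_mx.
by congr diag_mx; apply/rowP => i; rewrite !mxE dU.
Qed.
End UnitaryDensity.

(** * Extension of isometries to unitary matrices *)

Section IsometryExtension.
Variable C : numClosedFieldType.

Lemma adjmx_inj m n (A B : 'M[C]_(m, n)) : A^t* = B^t* -> A = B.
Proof. by move=> AB; rewrite -[A]trmxCK AB trmxCK. Qed.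

Lemma mulmx_adj_eq0 m n (A : 'M[C]_(m, n)) : A *m A^t* = 0 -> A = 0.
Proof.
move=> A0; apply/matrixP => i j; rewrite [RHS]mxE.
have /matrixP/(_ i i) := A0; rewrite mxE [RHS]mxE => /eqP.
rewrite psumr_eq0 => [/allP/(_ j)|k _]; last by rewrite adjmxE mul_conjC_ge0.
by rewrite mem_index_enum adjmxE mul_conjC_eq0 => /(_ isT)/eqP.
Qed.

(** Not to be iterated: the right-hand side is again an instance of the left-hand
side. *)
Lemma mulmx_adj_rowE m n p (A : 'M[C]_(m, n)) (B : 'M[C]_(p, n)) i j :
  (A *m B^t*) i j = (row i A *m (row j B)^t*) 0 0.
Proof. by rewrite !mxE; apply: eq_bigr => k _; rewrite !mxE. Qed.

Lemma unitarymx_complement r n (Q : 'M[C]_(r, n)) : Q \is unitarymx ->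
  exists Z : 'M[C]_(n - r, n),
    [/\ Z \is unitarymx, Q *m Z^t* = 0 & Q^t* *m Q + Z^t* *m Z = 1%:M].
Proof.
move=> QU; have QE := unitarymxP QU.
pose V := kermx (Q^t*).
have rQ : \rank Q = r by apply: mxrank_unitary.
have rV : \rank V = (n - r)%N by rewrite mxrank_ker mxrank_map mxrank_tr rQ.
pose Z0 := schmidt (row_base V).
have Z0U : Z0 \is unitarymx by apply: schmidt_unitarymx; apply: rank_leq_col.
have ZQ : Z0 *m Q^t* = 0.
  by apply/sub_kermxP; rewrite eqmx_schmidt_free ?row_base_free // eq_row_base.
rewrite -rV; exists Z0.
have QZ : Q *m Z0^t* = 0.
  by apply: adjmx_inj; rewrite adjmx_mul trmxCK ZQ !(trmx0, map_mx0).
split => //.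
have colU : col_mx Q Z0 \is unitarymx.
  apply/unitarymxP; rewrite tr_col_mx map_row_mx mul_col_row QE QZ ZQ.
  by rewrite (unitarymxP Z0U) -scalar_mx_block.
have szE : (r + \rank V)%N = n.
  by rewrite rV subnKC // -rQ rank_leq_col.
have := mulmxKtV (1%:M : 'M_n) colU szE.
by rewrite mul1mx tr_col_mx map_row_mx mul_row_col.
Qed.

(** Gram-Schmidt writes X = L Q with L invertible and Q orthonormal; equality of
the Gram matrices makes L^-1 Y orthonormal as well.  The isometry that maps Q to
L^-1 Y is completed by any isometry between the orthogonal complements. *)
Lemma free_isometry_extend r n (X Y : 'M[C]_(r, n)) : row_free X ->
  X *m X^t* = Y *m Y^t* -> exists2 U, U \is unitarymx & X *m U = Y.
Proof.
move=> Xf XY.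
have rn : (r <= n)%N by rewrite -(eqP Xf) rank_leq_col.
pose Q := schmidt X.
have QU : Q \is unitarymx by apply: schmidt_unitarymx.
have /submxP[L XE] : (X <= Q)%MS by apply: schmidt_sub.
have Lu : L \in unitmx.
  rewrite -row_free_unit /row_free eqn_leq rank_leq_row /=.
  by rewrite -[leqLHS](eqP Xf) XE mxrankM_maxl.
have LL : L *m L^t* = Y *m Y^t*.
  by rewrite -XY XE adjmx_mul mulmxA mulmxtVK.
have [Q2 Q2E] : exists Q2, Q2 = invmx L *m Y by exists (invmx L *m Y).
have LtK : L^t* *m (invmx L)^t* = 1%:M.
  by rewrite -adjmx_mul mulVmx // trmx1 map_mx1.
have Q2U : Q2 \is unitarymx.
  apply/unitarymxP; rewrite Q2E adjmx_mul mulmxA -(mulmxA _ Y) -LL mulmxA mulVmx //.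
  by rewrite mul1mx.
have [Z [ZU QZ QZ1]] := unitarymx_complement QU.
have [Z2 [Z2U QZ2 QZ21]] := unitarymx_complement Q2U.
have ZQ : Z *m Q^t* = 0.
  by apply: adjmx_inj; rewrite adjmx_mul trmxCK QZ !(trmx0, map_mx0).
have ZQ2 : Z2 *m Q2^t* = 0.
  by apply: adjmx_inj; rewrite adjmx_mul trmxCK QZ2 !(trmx0, map_mx0).
exists (Q^t* *m Q2 + Z^t* *m Z2).
  apply/unitarymxP; rewrite linearD map_mxD /= !adjmx_mul !trmxCK.
  rewrite mulmxDl !mulmxDr !mulmxA !(mulmxtVK _ Q2U) !(mulmxtVK _ Z2U).
  by rewrite -(mulmxA _ Q2) QZ2 -(mulmxA _ Z2) ZQ2 !mulmx0 !mul0mx addr0 add0r.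
rewrite XE mulmxDr !mulmxA mulmxtVK // -(mulmxA _ Q) QZ mulmx0 mul0mx addr0.
by rewrite Q2E mulKVmx.
Qed.

(** A finite subfamily of maximal rank spans all the x_i, so the isometry is
determined by finitely many vectors; that it maps every other x_i to y_i follows
from the Gram matrix, which shows that the difference has norm zero. *)
Lemma gram_rows_extend (I : Type) n (x y : I -> 'rV[C]_n) :
  (forall i j, x i *m (x j)^t* = y i *m (y j)^t*) ->
  exists2 U : 'M_n, U \is unitarymx & forall i, x i *m U = y i.
Proof.
move=> xy.
(* The finite subfamilies are indexed by ordinals and may have repetitions. *)
pose P r := `[< exists k (f : 'I_k -> I), \rank (\matrix_i x (f i)) = r >].
have Pn r : P r -> (r <= n)%N by move=> /asboolP[k [f <-]]; apply: rank_leq_col.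
have P0 : exists r, P r.
  exists 0%N; apply/asboolP; exists 0%N, (fun i : 'I_0 => False_rect I (notF (valP i))).
  by apply/eqP; rewrite -leqn0 rank_leq_row.
case: (ex_maxnP P0 Pn) => r /asboolP[k [f rE]] rmax.
pose X := \matrix_i x (f i); pose Y := \matrix_i y (f i).
have xX i : (x i <= X)%MS.
  pose f' (j : 'I_(k + 1)) := if split j is inl j' then f j' else i.
  have XE : \matrix_j x (f' j) = col_mx X (x i).
    apply/row_matrixP => j; rewrite rowK /f'.
    case: split_ordP => l -> /=.
      by rewrite rowKu rowK.
    by rewrite rowKd (ord1 l) row_id.
  have : (\rank (col_mx X (x i)) <= \rank X)%N.
    by rewrite rE; apply: rmax; apply/asboolP; exists (k + 1)%N, f'; rewrite XE.
  rewrite -addsmxE => le; apply: submx_trans (addsmxSr X (x i)) _.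
  by rewrite -(geq_leqif (mxrank_leqif_sup (addsmxSl X (x i)))).
have /submxP[B BE] : (row_base X <= X)%MS by rewrite eq_row_base.
have XY : X *m X^t* = Y *m Y^t*.
  by apply/matrixP => i j; rewrite mulmx_adj_rowE [RHS]mulmx_adj_rowE !rowK xy.
have [U UU XU] : exists2 U, U \is unitarymx & row_base X *m U = B *m Y.
  apply: free_isometry_extend; first exact: row_base_free.
  by rewrite BE !adjmx_mul !mulmxA -!(mulmxA B) XY.
exists U => // i.
have /submxP[c xE] : (x i <= row_base X)%MS by rewrite eq_row_base.
have xX2 : x i *m X^t* = y i *m Y^t*.
  by apply/matrixP => a j; rewrite mulmx_adj_rowE [RHS]mulmx_adj_rowE !rowK !row_id xy.
rewrite xE -mulmxA XU; set z := c *m (B *m Y).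
have xE' : x i = c *m B *m X by rewrite -mulmxA -BE.
have zE : z = c *m B *m Y by rewrite /z mulmxA.
have Yx : Y *m (y i)^t* = X *m (x i)^t*.
  by apply: adjmx_inj; rewrite !adjmx_mul !trmxCK xX2.
have e1 : y i *m z^t* = x i *m (x i)^t*.
  by rewrite {2}xE' zE adjmx_mul mulmxA -xX2 -mulmxA -adjmx_mul.
have e2 : z *m (y i)^t* = x i *m (x i)^t*.
  by rewrite zE -mulmxA Yx mulmxA -xE'.
have e3 : z *m z^t* = x i *m (x i)^t*.
  rewrite zE adjmx_mul mulmxA -(mulmxA _ Y) -XY xE'.
  by rewrite [in RHS]adjmx_mul !mulmxA.
apply/eqP; rewrite -subr_eq0; apply/eqP/mulmx_adj_eq0.
rewrite linearB map_mxB /= mulmxBl !mulmxBr e1 e2 e3 -xy.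
by rewrite !subrr.
Qed.

Lemma gram_columns_extend (I : Type) n N (x y : I -> 'M[C]_(n, N)) :
  (forall i j, (x i)^t* *m x j = (y i)^t* *m y j) ->
  exists2 U : 'M_n, U \is unitarymx & forall i, U *m x i = y i.
Proof.
move=> xy.
have [|U UU xU] := @gram_rows_extend (I * 'I_N) n
    (fun i => row i.2 ((x i.1)^t*)) (fun i => row i.2 ((y i.1)^t*)).
  move=> [i a] [j b] /=; apply/matrixP => u v; rewrite !ord1.
  by rewrite -mulmx_adj_rowE -[RHS]mulmx_adj_rowE !trmxCK xy.
exists (U^t*); first by rewrite trmxC_unitary.
move=> i; apply: adjmx_inj; rewrite adjmx_mul trmxCK.
by apply/row_matrixP => a; rewrite row_mul (xU (i, a)).
Qed.
End IsometryExtension.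

(** * Agler kernels *)

Section AglerKernels.
Variable C : numClosedFieldType.

(** Agler decompositions; the kernels that have one with respect to Z form the cone
generated by the congruences of 1 - Z^* Z. *)
Definition agler (X : Type) k N (Z : X -> 'M[C]_k) (K : X -> X -> 'M[C]_N) :=
  exists s : seq (X -> 'M[C]_(k, N)), forall x y,
    K x y = \sum_(H <- s) (H x)^t* *m (1%:M - (Z x)^t* *m Z y) *m H y.

Section Cone.
Variables (X : Type) (k : nat) (Z : X -> 'M[C]_k).

Lemma eq_agler N (K L : X -> X -> 'M[C]_N) :
  (forall x y, K x y = L x y) -> agler Z K -> agler Z L.
Proof. by move=> KL [s sP]; exists s => x y; rewrite -KL. Qed.

Lemma agler_gen N (H : X -> 'M[C]_(k, N)) :
  agler Z (fun x y => (H x)^t* *m (1%:M - (Z x)^t* *m Z y) *m H y).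
Proof. by exists [:: H] => x y; rewrite big_seq1. Qed.

Lemma agler0 N : agler Z (fun _ _ => 0 : 'M[C]_N).
Proof. by exists [::] => x y; rewrite big_nil. Qed.

Lemma aglerD N (K L : X -> X -> 'M[C]_N) :
  agler Z K -> agler Z L -> agler Z (fun x y => K x y + L x y).
Proof. by move=> [s sP] [r rP]; exists (s ++ r) => x y; rewrite big_cat /= sP rP. Qed.

Lemma agler_sum N I (r : seq I) (K : I -> X -> X -> 'M[C]_N) :
  (forall i, agler Z (K i)) -> agler Z (fun x y => \sum_(i <- r) K i x y).
Proof.
move=> Kp; elim: r => [|i r IHr].
  by apply: eq_agler (agler0 N) => x y; rewrite big_nil.
by apply: eq_agler (aglerD (Kp i) IHr) => x y; rewrite big_cons.
Qed.

Lemma agler_conj N N' (G : X -> 'M[C]_(N', N)) (K : X -> X -> 'M[C]_N') :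
  agler Z K -> agler Z (fun x y => (G x)^t* *m K x y *m G y).
Proof.
move=> [s sP]; exists [seq (fun x => H x *m G x) | H <- s] => x y.
rewrite sP big_map mulmx_sumr mulmx_suml; apply: eq_bigr => H _.
by rewrite adjmx_mul !mulmxA.
Qed.

End Cone.

Lemma agler_trans X k l N (Z : X -> 'M[C]_k) (W : X -> 'M[C]_l)
    (K : X -> X -> 'M[C]_N) :
  agler Z (fun x y => 1%:M - (W x)^t* *m W y) -> agler W K -> agler Z K.
Proof.
move=> ZW [s sP].
have := agler_sum s (fun H => agler_conj H ZW).
by apply: eq_agler => x y; rewrite sP.
Qed.

Lemma agler_comp X Y k N (Z : X -> 'M[C]_k) (K : X -> X -> 'M[C]_N) (f : Y -> X) :
  agler Z K -> agler (Z \o f) (fun x y => K (f x) (f y)).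
Proof. by move=> [s sP]; exists [seq H \o f | H <- s] => x y; rewrite sP big_map. Qed.
End AglerKernels.

(** * Transfer functions of unitary colligations *)

Section Transfer.
Variable C : numClosedFieldType.

Definition transfer a b (g : 'M[C]_(a + b)) (T : 'M[C]_b) : 'M[C]_a :=
  ulsubmx g + ursubmx g *m T *m invmx (1%:M - drsubmx g *m T) *m dlsubmx g.

Definition sqnorm n (v : 'cV[C]_n) : C := (v^t* *m v) 0 0.

Definition strict_contraction n (T : 'M[C]_n) :=
  forall v : 'cV_n, v != 0 -> sqnorm (T *m v) < sqnorm v.

Lemma sqnormE n (v : 'cV[C]_n) : sqnorm v = \sum_k `|v k 0| ^+ 2.
Proof.
by rewrite /sqnorm mxE; apply: eq_bigr => k _; rewrite adjmxE normCK mulrC.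
Qed.

Lemma sqnorm_ge0 n (v : 'cV[C]_n) : 0 <= sqnorm v.
Proof. by rewrite sqnormE; apply: sumr_ge0 => k _; rewrite exprn_ge0. Qed.

Lemma unitmx_kerP n (M : 'M[C]_n) :
  (forall v : 'cV_n, M *m v = 0 -> v = 0) -> M \in unitmx.
Proof.
move=> M0; rewrite -unitmx_tr -row_free_unit -kermx_eq0; apply/eqP/row_matrixP => i.
rewrite row0; apply: trmx_inj; rewrite trmx0; apply: M0.
by apply: trmx_inj; rewrite trmx_mul trmxK trmx0 -row_mul mulmx_ker row0.
Qed.

Variables (a b : nat) (g : 'M[C]_(a + b)) (gU : g \is unitarymx).

Lemma unitarymx_gram N (x y : 'M[C]_(a + b, N)) :
  (g *m x)^t* *m (g *m y) = x^t* *m y.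
Proof. by rewrite adjmx_mul mulmxA -(mulmxA _ (g^t*)) unitarymx_mulVl // mulmx1. Qed.

Lemma mul_unitary_col N (x : 'M[C]_(a, N)) (y : 'M_(b, N)) :
  g *m col_mx x y = col_mx (ulsubmx g *m x + ursubmx g *m y)
                           (dlsubmx g *m x + drsubmx g *m y).
Proof. by rewrite -{1}[g]submxK mul_block_col. Qed.

Lemma col_mx_gram N (x x' : 'M[C]_(a, N)) (y y' : 'M_(b, N)) :
  (col_mx x y)^t* *m col_mx x' y' = x^t* *m x' + y^t* *m y'.
Proof. by rewrite tr_col_mx map_row_mx mul_row_col. Qed.

Variable (T : 'M[C]_b) (Tlt : strict_contraction T).

(** A vector v with v = d T v would satisfy |v| <= |T v|, since d is a block of a
unitary matrix, whereas T is strictly contracting. *)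
Lemma resolvent_unit : 1%:M - drsubmx g *m T \in unitmx.
Proof.
apply: unitmx_kerP => v; rewrite mulmxBl mul1mx => /eqP; rewrite subr_eq0 => /eqP vE.
apply/eqP/contraT => /Tlt lt.
suff : sqnorm v <= sqnorm (T *m v) by move/(lt_le_trans lt); rewrite ltxx.
have := unitarymx_gram (col_mx 0 (T *m v)) (col_mx 0 (T *m v)).
rewrite mul_unitary_col !mulmx0 !add0r (mulmxA (drsubmx g)) -vE !col_mx_gram.
rewrite mulmx0 add0r => /matrixP/(_ 0 0); rewrite mxE -!/(sqnorm _) => <-.
by rewrite lerDr sqnorm_ge0.
Qed.

(** The feedback form of the transfer function: the unitary matrix g maps the
input x together with the fed back state T H to the output y together with the
state H; eliminating H gives the transfer function. *)
Lemma transfer_state N (H : 'M[C]_(b, N)) (x y : 'M_(a, N)) :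
  g *m col_mx x (T *m H) = col_mx y H -> y = transfer g T *m x.
Proof.
rewrite mul_unitary_col => /eq_col_mx[<- HE].
have /(congr1 (mulmx (invmx (1%:M - drsubmx g *m T)))) :
    (1%:M - drsubmx g *m T) *m H = dlsubmx g *m x.
  by rewrite mulmxBl mul1mx -{1}HE mulmxA addrK.
rewrite mulKmx ?resolvent_unit // => HE'.
by rewrite /transfer mulmxDl -!mulmxA -HE'.
Qed.

Lemma transfer_stateE (H := invmx (1%:M - drsubmx g *m T) *m dlsubmx g) :
  g *m col_mx 1%:M (T *m H) = col_mx (transfer g T) H.
Proof.
rewrite mul_unitary_col !mulmx1 /transfer; congr col_mx; first by rewrite /H !mulmxA.
have : (1%:M - drsubmx g *m T) *m H = dlsubmx g by rewrite mulKVmx ?resolvent_unit.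
by rewrite mulmxBl mul1mx mulmxA => <-; rewrite subrK.
Qed.
End Transfer.

(** * Agler kernels and realizations *)

Section Realization.
Variable C : numClosedFieldType.

(** The rows of H are indexed by pairs, in the order for which the matrix
[tensmx S 1%:M] acts as S on each slice. *)
Definition slice m j N (t : 'I_j) (H : 'M[C]_(m * j, N)) : 'M[C]_(m, N) :=
  \matrix_(k, c) H (mxtens_index (k, t)) c.

Definition stack m j N (h : 'I_j -> 'M[C]_(m, N)) : 'M[C]_(m * j, N) :=
  \matrix_(u, c) h (mxtens_unindex u).2 (mxtens_unindex u).1 c.

Lemma stackK m j N (h : 'I_j -> 'M[C]_(m, N)) t : slice t (stack h) = h t.
Proof. by apply/matrixP => k c; rewrite !mxE mxtens_indexK. Qed.

Lemma sum_mxtens_index m j (f : 'I_(m * j) -> C) :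
  \sum_u f u = \sum_(t < j) \sum_(k < m) f (mxtens_index (k, t)).
Proof.
rewrite exchange_big pair_big /=.
rewrite (reindex (@mxtens_index m j)) /=; last first.
  by exists (@mxtens_unindex m j) => u _; rewrite (mxtens_indexK, mxtens_unindexK).
by apply: eq_bigr => -[].
Qed.

Lemma slice_tens m j N t (S : 'M[C]_m) (H : 'M_(m * j, N)) :
  slice t (tensmx S (1%:M : 'M_j) *m H) = S *m slice t H.
Proof.
apply/matrixP => k c; rewrite !mxE sum_mxtens_index (bigD1 t) //= [X in _ + X]big1.
  by rewrite addr0; apply: eq_bigr => l _; rewrite tensmxE !mxE eqxx mulr1.
move=> s st; apply: big1 => l _.
by rewrite tensmxE !mxE eq_sym (negbTE st) mulr0 mul0r.
Qed.

Lemma slice_gram m j N N' (G : 'M[C]_(m * j, N)) (H : 'M_(m * j, N')) :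
  G^t* *m H = \sum_(t < j) (slice t G)^t* *m slice t H.
Proof.
apply/matrixP => p q; rewrite mxE summxE sum_mxtens_index; apply: eq_bigr => t _.
by rewrite mxE; apply: eq_bigr => k _; rewrite !mxE.
Qed.

Lemma slice_defect m j N N' (S S' : 'M[C]_m) (G : 'M_(m * j, N)) (H : 'M_(m * j, N')) :
  \sum_(t < j) (slice t G)^t* *m (1%:M - S^t* *m S') *m slice t H =
  G^t* *m H - (tensmx S (1%:M : 'M_j) *m G)^t* *m (tensmx S' (1%:M : 'M_j) *m H).
Proof.
rewrite !slice_gram -sumrB; apply: eq_bigr => t _.
by rewrite !slice_tens adjmx_mul mulmxBr mulmx1 mulmxBl !mulmxA.
Qed.

Lemma tens_strict_contraction m j (S : 'M[C]_m) : strict_contraction S ->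
  strict_contraction (tensmx S (1%:M : 'M_j)).
Proof.
move=> Slt v vn0.
have sqE (w : 'cV[C]_(m * j)) : sqnorm w = \sum_t sqnorm (slice t w).
  by rewrite /sqnorm slice_gram summxE.
have [t tn0] : exists t, slice t v != 0.
  apply/existsP; apply: contraNT vn0; rewrite negb_exists => /forallP v0.
  apply/eqP/matrixP => u c; case: (mxtens_indexP u) => k t.
  by have /eqP/matrixP/(_ k c) := negbNE (v0 t); rewrite !mxE.
rewrite !sqE (bigD1 t) //= [ltRHS](bigD1 t) //= slice_tens.
apply: ltr_leD; first exact: Slt.
apply: ler_sum => s _; rewrite slice_tens.
have [->|/Slt/ltW //] := eqVneq (slice s v) 0.
by rewrite mulmx0.
Qed.

(** With the state H, the unitary matrix of the colligation maps (1, T H) to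
(F, H); equating Gram matrices gives 1 - F^* F = H^* H - (T H)^* (T H). *)
Lemma transfer_agler (X : Type) m j alpha (Z : X -> 'M[C]_m)
    (g : 'M_(alpha + m * j)) :
  g \is unitarymx -> (forall x, strict_contraction (Z x)) ->
  let F x := transfer g (tensmx (Z x) (1%:M : 'M_j)) in
  agler Z (fun x y => 1%:M - (F x)^t* *m F y).
Proof.
move=> gU Zlt F.
pose H x := invmx (1%:M - drsubmx g *m tensmx (Z x) 1%:M) *m dlsubmx g.
have := agler_sum (index_enum 'I_j) (fun t => agler_gen Z (fun x => slice t (H x))).
apply: eq_agler => x y; symmetry.
have Tlt w := tens_strict_contraction (j := j) (Zlt w).
have := unitarymx_gram gU (col_mx 1%:M (tensmx (Z x) 1%:M *m H x))
                          (col_mx 1%:M (tensmx (Z y) 1%:M *m H y)).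
rewrite !(transfer_stateE gU) // !col_mx_gram trmx1 map_mx1 mul1mx.
rewrite slice_defect -/(F x) -/(F y) => e.
by rewrite -[1%:M](addrK ((tensmx (Z x) 1%:M *m H x)^t* *m (tensmx (Z y) 1%:M *m H y)))
           -e addrAC (addrC ((F x)^t* *m _)) addrK.
Qed.

(** Lurking isometry: the decomposition says that (1, T H) and (F, H) have the
same Gram matrix, so that a unitary matrix maps the former to the latter. *)
Lemma agler_transfer (X : Type) m alpha (Z : X -> 'M[C]_m) (F : X -> 'M[C]_alpha) :
  (forall x, strict_contraction (Z x)) ->
  agler Z (fun x y => 1%:M - (F x)^t* *m F y) ->
  exists j, exists2 g : 'M[C]_(alpha + m * j), g \is unitarymx &
    forall x, F x = transfer g (tensmx (Z x) (1%:M : 'M_j)).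
Proof.
move=> Zlt [s sP]; exists (size s).
pose h x (t : 'I_(size s)) := (tnth (in_tuple s) t) x.
pose H x := stack (h x).
pose T x := tensmx (Z x) (1%:M : 'M[C]_(size s)).
have [x y|g gU gE] := @gram_columns_extend C X _ _
    (fun x => col_mx 1%:M (T x *m H x)) (fun x => col_mx (F x) (H x)).
  have := sP x y; rewrite big_tnth -/(size s).
  under eq_bigr => t _ do rewrite -/(h x t) -/(h y t) -(stackK (h x)) -(stackK (h y)).
  rewrite slice_defect -/(H x) -/(H y) -/(T x) -/(T y) => e.
  rewrite !col_mx_gram trmx1 map_mx1 mul1mx.
  by rewrite -[1%:M](subrK ((F x)^t* *m F y)) e addrAC subrK addrC.
exists g => // x.
have := transfer_state gU (tens_strict_contraction (Zlt x)) (gE x).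
by rewrite mulmx1.
Qed.
End Realization.

(** * Polynomials along lines and their partial derivatives *)

Section MPolyLines.
Variables (C : numClosedFieldType) (n : nat).
Implicit Types (p q : mpoly.mpoly n C) (v w : 'I_n -> C).

Local Notation mderiv := mpoly.mderiv.
Local Notation meval := mpoly.meval.
Local Notation mcoeff := mpoly.mcoeff.

(** The chain rule along a line, which turns statements about partial derivatives
into statements about evaluations. *)
Definition line_deriv p := forall v w, exists q : {poly C},
  (forall t, meval (fun i => v i + t * w i) p = q.[t]) /\
  q^`().[0] = \sum_i w i * meval v (mderiv i p).

Lemma line_derivC c : line_deriv (mpoly.mpolyC n c).
Proof.
move=> v w; exists c%:P; split=> [t|]; first by rewrite mpoly.mevalC hornerC.
rewrite derivC horner0 big1 // => i _.
by rewrite mpoly.mderivC mpoly.meval0 mulr0.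
Qed.

Lemma line_derivX i : line_deriv (mpoly.mpolyX C (mpoly.mnm1 i)).
Proof.
move=> v w; exists ((v i)%:P + w i *: 'X); split=> [t|].
  by rewrite mpoly.mevalXU !hornerE mulrC.
rewrite derivD derivC add0r derivZ derivX alg_polyC hornerC.
rewrite (bigD1 i) //= big1 ?addr0 => [|j ji].
  rewrite mpoly.mderivX mpoly.mnm1E eqxx scale1r.
  rewrite (_ : mpoly.mnm_sub _ _ = mpoly.mnm0); last first.
    by apply/mpoly.mnmP => j; rewrite mpoly.mnmBE mpoly.mnm0E subnn.
  by rewrite mpoly.mpolyX0 mpoly.meval1 mulr1.
by rewrite mpoly.mderivX mpoly.mnm1E eq_sym (negbTE ji) scale0r mpoly.meval0 mulr0.
Qed.

Lemma line_derivD p q : line_deriv p -> line_deriv q -> line_deriv (p + q).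
Proof.
move=> dp dq v w; have [P [PE P']] := dp v w; have [Q [QE Q']] := dq v w.
exists (P + Q); split=> [t|]; first by rewrite mpoly.mevalD hornerD PE QE.
rewrite derivD hornerD P' Q' -big_split; apply: eq_bigr => i _ /=.
by rewrite mpoly.mderivD mpoly.mevalD mulrDr.
Qed.

Lemma line_derivM p q : line_deriv p -> line_deriv q -> line_deriv (p * q).
Proof.
move=> dp dq v w; have [P [PE P']] := dp v w; have [Q [QE Q']] := dq v w.
exists (P * Q); split=> [t|]; first by rewrite mpoly.mevalM hornerM PE QE.
have v0 f : meval (fun i => v i + 0 * w i) f = meval v f.
  by apply: mpoly.meval_eq => i; rewrite mul0r addr0.
rewrite derivM hornerD !hornerM P' Q' -PE -QE !v0 mulr_suml mulr_sumr -big_split.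
apply: eq_bigr => i _ /=.
by rewrite mpoly.mderivM mpoly.mevalD !mpoly.mevalM; ring.
Qed.

Lemma line_derivP p : line_deriv p.
Proof.
elim/mpoly.mpolyind: p => [|c m p _ _ IH]; first exact: (line_derivC 0).
apply: line_derivD => //; rewrite -mpoly.mul_mpolyC.
apply: line_derivM; first exact: line_derivC.
rewrite mpoly.mpolyXE_id.
elim/big_ind: _ => [|? ?|i _]; [exact: (line_derivC 1)|exact: line_derivM|].
elim: (m i) => [|k IHk]; first exact: (line_derivC 1).
by rewrite exprS; apply: line_derivM => //; apply: line_derivX.
Qed.

(** A degree bound that is easier to decrease by differentiation than an equality
on degrees. *)
Definition mdeg_lt d p := forall m, (d <= mpoly.mdeg m)%N -> mcoeff m p = 0.

Lemma mdeg_lt0 p : mdeg_lt 0 p -> p = 0.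
Proof. by move=> p0; apply/mpoly.mpolyP => m; rewrite p0 // mpoly.mcoeff0. Qed.

Lemma mdeg_ltE d p : (mpoly.mmeasure mpoly.mdeg p <= d)%N -> mdeg_lt d p.
Proof.
move=> pd m dm; apply: mpoly.memN_msupp_eq0; apply: mpoly.msize_mdeg_ge.
exact: leq_trans dm.
Qed.

Lemma mdeg_lt_mderiv d p i : mdeg_lt d.+1 p -> mdeg_lt d (mderiv i p).
Proof.
move=> pd m dm; rewrite mpoly.mcoeff_mderiv pd ?mul0rn //.
by rewrite mpoly.mdegD mpoly.mdeg1 addn1.
Qed.

Lemma mderiv_eq0_meval p :
  (forall i, mderiv i p = 0) -> meval (fun=> 0) p = 0 -> p = 0.
Proof.
move=> p'0 p0.
have mc m : m != mpoly.mnm0 -> mcoeff m p = 0.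
  move=> mn0.
  have [i mi] : exists i, mpoly.fun_of_multinom m i != 0%N.
    apply/existsP; apply: contraNT mn0; rewrite negb_exists => /forallP m0.
    by apply/eqP/mpoly.mnmP => i; rewrite mpoly.mnm0E; apply/eqP/negbNE.
  pose m' := mpoly.mnm_sub m (mpoly.mnm1 i).
  have := mpoly.mcoeff_mderiv i p m'.
  rewrite p'0 mpoly.mcoeff0 mpoly.submK; last by rewrite mpoly.lep1mP.
  by move/esym/eqP; rewrite mulrn_eq0 => /eqP.
have pE : p = mpoly.mpolyC n (mcoeff mpoly.mnm0 p).
  apply/mpoly.mpolyP => m; rewrite mpoly.mcoeffC.
  by have [->|/mc ->] := eqVneq m mpoly.mnm0; rewrite ?mulr1 ?mulr0.
by move: p0; rewrite pE mpoly.mevalC => ->.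
Qed.

Lemma meval_mderiv_eq0 p i :
  (forall v, meval v p = 0) -> forall v, meval v (mderiv i p) = 0.
Proof.
move=> p0 v; have [q [qE q']] := line_derivP p v (fun j => (j == i)%:R).
have q0 : q = 0 by apply: polyC_unit_circle_eq0 => t _; rewrite -qE.
move: q'; rewrite q0 deriv0 horner0 (bigD1 i) //= eqxx mul1r big1 ?addr0 // => j.
by move/negbTE=> ->; rewrite mul0r.
Qed.

(** The derivatives of a polynomial that vanishes as a function also vanish as
functions, and one concludes by induction on the degree. *)
Lemma meval_eq0 p : (forall v, meval v p = 0) -> p = 0.
Proof.
have [d] : exists d, mdeg_lt d p by exists (mpoly.mmeasure (@mpoly.mdeg n) p); apply: mdeg_ltE.
elim: d p => [|d IHd] p pd p0; first exact: mdeg_lt0.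
apply: mderiv_eq0_meval => // i; apply: IHd; first exact: mdeg_lt_mderiv.
exact: meval_mderiv_eq0.
Qed.

Lemma meval_inj p q : (forall v, meval v p = meval v q) -> p = q.
Proof.
move=> pq; apply/eqP; rewrite -subr_eq0; apply/eqP/meval_eq0 => v.
by rewrite mpoly.mevalB pq subrr.
Qed.
End MPolyLines.

(** * Right translation and the Fischer inner product *)

Section Fischer.
Variables (C : numClosedFieldType) (n : nat).
Implicit Types (p q : mpoly.mpoly (n * n) C) (A B g h : 'M[C]_n).

Definition mxeval g p : C := mpoly.meval (fun t => mxvec g 0 t) p.

Definition pder (i j : 'I_n) p := mpoly.mderiv (mxvec_index i j) p.

(** Right translation p(g) |-> p(g h): the indeterminates are replaced by the
entries of g h, which are linear in those of g. *)
Definition rtrans h p : mpoly.mpoly (n * n) C :=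
  mpoly.comp_mpoly [tuple \sum_s lin_mulmxr h s t *: mpoly.mpolyX C (mpoly.mnm1 s)
                   | t < n * n] p.

Lemma sum_mxvec_index (f : 'I_(n * n) -> C) :
  \sum_t f t = \sum_i \sum_j f (mxvec_index i j).
Proof.
rewrite pair_big /= (reindex _ (curry_mxvec_bij _ _)) /=.
by apply: eq_bigr => -[].
Qed.

Lemma mxeval_rtrans g h p : mxeval g (rtrans h p) = mxeval (g *m h) p.
Proof.
rewrite /mxeval /rtrans mpoly.comp_mpoly_meval; apply: mpoly.meval_eq => t.
rewrite tnth_mktuple raddf_sum /=.
have /matrixP/(_ 0 t) := mul_rV_lin (mulmxr h) (mxvec g).
rewrite mxvecK /= => <-; rewrite mxE; apply: eq_bigr => s _.
by rewrite mpoly.mevalZ mpoly.mevalXU mulrC.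
Qed.

Lemma mxeval_line p A B : exists q : {poly C},
  (forall t, mxeval (A + t *: B) p = q.[t]) /\
  q^`().[0] = \sum_i \sum_j B i j * mxeval A (pder i j p).
Proof.
have [q [qE q']] := line_derivP p (fun t => mxvec A 0 t) (fun t => mxvec B 0 t).
exists q; split=> [t|]; last first.
  by rewrite q' sum_mxvec_index; under eq_bigr do under eq_bigr do rewrite mxvecE.
by rewrite -qE; apply: mpoly.meval_eq => s; rewrite linearD linearZ !mxE.
Qed.

Lemma line_poly_mxeval p : line_poly (mxeval^~ p).
Proof. by move=> A B; have [q [qE _]] := mxeval_line p A B; exists q. Qed.

Lemma mxeval_inj p q : (forall g, mxeval g p = mxeval g q) -> p = q.
Proof.
move=> pq; apply: meval_inj => v.
have := pq (vec_mx (\row_t v t)).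
by rewrite /mxeval vec_mxK; under mpoly.meval_eq do rewrite mxE;
   under [RHS]mpoly.meval_eq do rewrite mxE.
Qed.

Lemma mxevalZ g c p : mxeval g (c *: p) = c * mxeval g p.
Proof. exact: mpoly.mevalZ. Qed.

Lemma mxeval_sum g I (r : seq I) (f : I -> mpoly.mpoly (n * n) C) :
  mxeval g (\sum_(i <- r) f i) = \sum_(i <- r) mxeval g (f i).
Proof. exact: raddf_sum. Qed.

Lemma pder_sumZ i j I (r : seq I) (c : I -> C) (f : I -> mpoly.mpoly (n * n) C) :
  pder i j (\sum_(k <- r) c k *: f k) = \sum_(k <- r) c k *: pder i j (f k).
Proof. by rewrite /pder raddf_sum; apply: eq_bigr => k _; apply: mpoly.mderivZ. Qed.

Definition row_der h i k p := \sum_j h k j *: pder i j p.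

(** Chain rule: moving g in the direction E_ik moves g h in the direction
E_ik h, whose only nonzero row is the i-th one, equal to the k-th row of h. *)
Lemma pder_rtrans h i k p : pder i k (rtrans h p) = rtrans h (row_der h i k p).
Proof.
apply: mxeval_inj => g; rewrite [RHS]mxeval_rtrans [RHS]mxeval_sum.
have [P [PE P']] := mxeval_line (rtrans h p) g (delta_mx i k).
have [Q [QE Q']] := mxeval_line p (g *m h) (delta_mx i k *m h).
have PQ : P = Q.
  apply/eqP; rewrite -subr_eq0; apply/eqP/polyC_unit_circle_eq0 => t _.
  by rewrite hornerD hornerN -PE -QE mxeval_rtrans mulmxDl -scalemxAl subrr.
transitivity P^`().[0].
  rewrite P' [RHS](bigD1 i) //= [X in _ = X + _](bigD1 k) //= mxE !eqxx mul1r.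
  rewrite [X in _ = _ + X + _]big1 => [|b bk]; last first.
    by rewrite mxE (negbTE bk) andbF mul0r.
  rewrite [X in _ = _ + X]big1 ?addr0 // => a ai.
  by apply: big1 => b _; rewrite mxE (negbTE ai) mul0r.
rewrite PQ Q' [LHS](bigD1 i) //= [X in _ + X]big1 ?addr0 => [|a ai].
  apply: eq_bigr => j _; rewrite mxevalZ mxE (bigD1 k) //= mxE !eqxx mul1r.
  by rewrite big1 ?addr0 // => b bk; rewrite mxE (negbTE bk) andbF mul0r.
rewrite big1 // => b _; rewrite mxE big1 ?mul0r // => c _.
by rewrite mxE (negbTE ai) mul0r.
Qed.

(** The part of degree d of the Fischer inner product, up to the factor d!.  The
recursion on the degree makes the telescoping below an induction. *)
Fixpoint fischer d p q : C :=
  if d is d'.+1 then \sum_i \sum_j fischer d' (pder i j p) (pder i j q)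
  else (mxeval 0 p)^* * mxeval 0 q.

Lemma fischer_sumr d p I (r : seq I) (c : I -> C) (f : I -> mpoly.mpoly (n * n) C) :
  fischer d p (\sum_(k <- r) c k *: f k) = \sum_(k <- r) c k * fischer d p (f k).
Proof.
elim: d p f => [|d IHd] p f /=.
  rewrite mxeval_sum mulr_sumr; apply: eq_bigr => k _.
  by rewrite mxevalZ mulrCA.
under [RHS]eq_bigr => k _ do rewrite mulr_sumr.
rewrite [RHS]exchange_big; apply: eq_bigr => i _.
under [RHS]eq_bigr => k _ do rewrite mulr_sumr.
rewrite [RHS]exchange_big; apply: eq_bigr => j _.
by rewrite pder_sumZ IHd.
Qed.

Lemma fischerC d p q : fischer d q p = (fischer d p q)^*.
Proof.
elim: d p q => [|d IHd] p q /=; first by rewrite rmorphM /= conjCK mulrC.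
rewrite rmorph_sum; apply: eq_bigr => i _.
by rewrite rmorph_sum; apply: eq_bigr => j _.
Qed.

Lemma fischer_suml d q I (r : seq I) (c : I -> C) (f : I -> mpoly.mpoly (n * n) C) :
  fischer d (\sum_(k <- r) c k *: f k) q = \sum_(k <- r) (c k)^* * fischer d (f k) q.
Proof.
rewrite fischerC fischer_sumr rmorph_sum; apply: eq_bigr => k _.
by rewrite rmorphM /= fischerC conjCK.
Qed.

Lemma fischer_ge0 d p : 0 <= fischer d p p.
Proof.
elim: d p => [|d IHd] p /=; first by rewrite mulrC mul_conjC_ge0.
by apply: sumr_ge0 => i _; apply: sumr_ge0.
Qed.

Lemma fischer_eq0 D p : mdeg_lt D p ->
  (forall d, (d < D)%N -> fischer d p p = 0) -> p = 0.
Proof.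
elim: D p => [|D IHD] p pD p0; first exact: mdeg_lt0.
apply: mderiv_eq0_meval => [t|].
  case/mxvec_indexP: t => i j; apply: IHD; first exact: mdeg_lt_mderiv.
  move=> d dD; have /= /eqP := p0 d.+1 dD.
  rewrite psumr_eq0 => [/allP/(_ i)|k _]; last by apply: sumr_ge0 => l _; apply: fischer_ge0.
  rewrite mem_index_enum => /(_ isT) /=.
  rewrite psumr_eq0 => [/allP/(_ j)|k _]; last exact: fischer_ge0.
  by rewrite mem_index_enum => /(_ isT)/eqP.
have /= /eqP := p0 0%N isT; rewrite mulrC mul_conjC_eq0 => /eqP.
by rewrite /mxeval linear0; under mpoly.meval_eq do rewrite mxE.
Qed.

Variables (X : Type) (Z : X -> 'M[C]_n) (N : nat).

(** Unfolding the recursion expresses the Fischer products through values at zero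
of derivatives, so that the kernel becomes a sum of generators. *)
Lemma agler_fischer_defect d (Y : 'I_n -> 'I_N -> X -> mpoly.mpoly (n * n) C) :
  agler Z (fun x y => \matrix_(a, b) \sum_j \sum_l
    (1%:M - (Z x)^t* *m Z y) j l * fischer d (Y j a x) (Y l b y)).
Proof.
elim: d Y => [|d IHd] Y.
  apply: eq_agler (agler_gen Z (fun x => \matrix_(l, b) mxeval 0 (Y l b x))) => x y.
  apply/matrixP => a b; rewrite !mxE exchange_big; apply: eq_bigr => l _.
  rewrite mxE mulr_suml; apply: eq_bigr => j _; rewrite /= !mxE; ring.
have := agler_sum (index_enum 'I_n) (fun i =>
  agler_sum (index_enum 'I_n) (fun k => IHd (fun j a x => pder i k (Y j a x)))).
apply: eq_agler => x y; apply/matrixP => a b; rewrite summxE !mxE /=.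
under eq_bigr => i _ do rewrite summxE; under eq_bigr => i _ do under eq_bigr => k _ do rewrite mxE.
under eq_bigr => i _ do rewrite exchange_big /=.
rewrite exchange_big /=; apply: eq_bigr => j _.
under eq_bigr => i _ do rewrite exchange_big /=.
rewrite exchange_big /=; apply: eq_bigr => l _.
rewrite mulr_sumr; apply: eq_bigr => i _.
by rewrite mulr_sumr.
Qed.

(** Telescoping.  By the chain rule, translation acts on the first derivatives by
a factor Z and by translation, and in
  <p, q>_(d+1) - <Rp, Rq>_(d+1)
the factor Z contributes the defect 1 - Z^* Z paired with Fischer products of
degree d, while the translation contributes the same difference in degree d for
the combinations [row_der] of derivatives. *)
Lemma agler_fischer_rtrans d (q : 'I_N -> X -> mpoly.mpoly (n * n) C) :
  agler Z (fun x y => \matrix_(a, b)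
    (fischer d (q a x) (q b y)
     - fischer d (rtrans (Z x) (q a x)) (rtrans (Z y) (q b y)))).
Proof.
elim: d q => [|d IHd] q.
  apply: eq_agler (agler0 Z N) => x y; apply/matrixP => a b; rewrite !mxE /=.
  by rewrite !mxeval_rtrans !mul0mx subrr.
have := aglerD
  (agler_sum (index_enum 'I_n) (fun i =>
     agler_fischer_defect d (fun j a x => pder i j (q a x))))
  (agler_sum (index_enum 'I_n) (fun i => agler_sum (index_enum 'I_n) (fun k =>
     IHd (fun a x => row_der (Z x) i k (q a x))))).
apply: eq_agler => x y; apply/matrixP => a b; rewrite !mxE !summxE /=.
rewrite -sumrB -big_split; apply: eq_bigr => i _ /=.
rewrite mxE summxE -sumrB.
under [X in _ + X = _]eq_bigr => k _ do rewrite mxE -!pder_rtrans.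
rewrite !sumrB addrA; congr (_ - _).
transitivity (\sum_j \sum_l (1%:M : 'M[C]_n) j l *
    fischer d (pder i j (q a x)) (pder i l (q b y))); last first.
  apply: eq_bigr => j _; rewrite (bigD1 j) //= mxE eqxx mul1r big1 ?addr0 // => l lj.
  by rewrite mxE eq_sym (negbTE lj) mul0r.
rewrite [X in _ + X](_ : _ = \sum_j \sum_l ((Z x)^t* *m Z y) j l *
    fischer d (pder i j (q a x)) (pder i l (q b y))).
  rewrite -big_split; apply: eq_bigr => j _ /=; rewrite -big_split; apply: eq_bigr => l _ /=.
  by rewrite -mulrDl !mxE subrK.
under eq_bigr => k _ do rewrite /row_der fischer_suml.
rewrite exchange_big; apply: eq_bigr => j _ /=.
under eq_bigr => k _ do rewrite fischer_sumr mulr_sumr.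
rewrite exchange_big; apply: eq_bigr => l _ /=.
rewrite mxE mulr_suml; apply: eq_bigr => k _.
by rewrite adjmxE mulrA.
Qed.
End Fischer.

(** * Polynomial representations *)

Lemma diag_mx_comm_fun (F : fieldType) n (d e : 'rV[F]_n) (A : 'M_n) :
  (forall i j, d 0 i = d 0 j -> e 0 i = e 0 j) ->
  diag_mx d *m A = A *m diag_mx d -> diag_mx e *m A = A *m diag_mx e.
Proof.
move=> de dA; apply/matrixP => i j; have /matrixP/(_ i j) := dA.
rewrite !mul_diag_mx !mul_mx_diag !mxE.
have [->|A0] := eqVneq (A i j) 0; first by rewrite !(mulr0, mul0r).
by rewrite mulrC => /(mulfI A0)/de ->; rewrite mulrC.
Qed.

Section PolynomialRepresentation.
Variables (C : numClosedFieldType) (n N : nat).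
Variable P : 'M[mpoly.mpoly (n * n) C]_N.

Definition pev (g : 'M[C]_n) : 'M[C]_N := \matrix_(k, l) mxeval g (P k l).

Hypothesis pev1 : pev 1%:M = 1%:M.
Hypothesis pevU : {in unitarymx, forall g, pev g \is unitarymx}.
Hypothesis pevMU : {in unitarymx &, forall g h, pev (g *m h) = pev g *m pev h}.

Lemma line_poly_pev k l : line_poly (fun g => pev g k l).
Proof.
move=> A B; have [q qE] := line_poly_mxeval (P k l) A B.
by exists q => t; rewrite mxE qE.
Qed.

(** The unitary trick is applied to each variable in turn. *)
Lemma pevM g h : pev (g *m h) = pev g *m pev h.
Proof.
have lM (u : 'M[C]_n) k l : line_poly (fun v => pev (u *m v) k l - (pev u *m pev v) k l).
  apply: line_polyB; first exact: (line_poly_mulmxl u (line_poly_pev k l)).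
  by apply: line_poly_mulmx => *; [apply: line_poly_const|apply: line_poly_pev].
have rM (v : 'M[C]_n) k l : line_poly (fun u => pev (u *m v) k l - (pev u *m pev v) k l).
  apply: line_polyB; first exact: (line_poly_mulmxr v (line_poly_pev k l)).
  by apply: line_poly_mulmx => *; [apply: line_poly_pev|apply: line_poly_const].
apply/matrixP => k l; apply/eqP; rewrite -subr_eq0; apply/eqP; move: h.
have H1 v : v \is unitarymx -> pev (g *m v) k l - (pev g *m pev v) k l = 0.
  move=> vU; move: g; apply: (line_poly_unitary_eq0 (rM v k l)) => u uU.
  by rewrite pevMU // subrr.
exact: (line_poly_unitary_eq0 (lM g k l) H1).
Qed.

(* A bound for the degrees of all matrix elements. *)
Let D := (\max_k \max_l mpoly.mmeasure (@mpoly.mdeg (n * n)) (P k l))%N.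

(** The inner product on the representation space that is pulled back from the
Fischer inner product by v |-> P v, a column of polynomials. *)
Definition fischer_gram : 'M[C]_N :=
  \sum_r \sum_(d < D) \matrix_(a, b) fischer d (P r a) (P r b).

Local Notation M := fischer_gram.

Lemma rtrans_entry h r c : rtrans h (P r c) = \sum_b pev h b c *: P r b.
Proof.
apply: mxeval_inj => g; rewrite mxeval_rtrans mxeval_sum.
have /matrixP/(_ r c) := pevM g h; rewrite mxE => ->; rewrite mxE.
by apply: eq_bigr => b _; rewrite mxevalZ !mxE mulrC.
Qed.

Lemma agler_fischer_gram :
  agler id (fun A B => M - (pev A)^t* *m M *m pev B).
Proof.
have := agler_sum (index_enum 'I_N) (fun r => agler_sum (index_enum 'I_D)
  (fun d => agler_fischer_rtrans id d (fun a _ => P r a))).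
apply: eq_agler => A B; rewrite /M mulmx_sumr mulmx_suml -sumrB.
apply: eq_bigr => r _; rewrite mulmx_sumr mulmx_suml -sumrB.
apply: eq_bigr => d _; apply/matrixP => a b; rewrite !mxE; congr (_ - _).
rewrite !rtrans_entry fischer_sumr. apply: eq_bigr => e _.
rewrite fischer_suml mulrC [X in _ = X * _]mxE; congr (_ * _).
by apply: eq_bigr => c _; rewrite adjmxE; congr (_ * _); rewrite mxE.
Qed.

(** On unitary matrices the generators of Agler kernels vanish. *)
Lemma fischer_gram_unitary u : u \is unitarymx -> (pev u)^t* *m M *m pev u = M.
Proof.
move=> uU; have [s sP] := agler_fischer_gram.
apply/esym/eqP; rewrite -subr_eq0 sP; apply/eqP/big1 => H _.
by rewrite unitarymx_mulVl // subrr mulmx0 mul0mx.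
Qed.

Lemma fischer_gram_comm_unitary u : u \is unitarymx -> M *m pev u = pev u *m M.
Proof.
move=> uU; rewrite -{2}(fischer_gram_unitary uU) !mulmxA.
by rewrite (unitarymxP (pevU uU)) mul1mx.
Qed.

Lemma fischer_gram_herm : M^t* = M.
Proof.
rewrite /M; apply/matrixP => a b; rewrite adjmxE !summxE rmorph_sum.
apply: eq_bigr => r _; rewrite !summxE rmorph_sum; apply: eq_bigr => d _.
by rewrite !mxE [RHS]fischerC.
Qed.

Lemma fischer_gram_form (v : 'cV[C]_N) :
  (v^t* *m M *m v) 0 0 =
  \sum_r \sum_(d < D) fischer d (\sum_b v b 0 *: P r b) (\sum_b v b 0 *: P r b).
Proof.
rewrite /M mulmx_sumr mulmx_suml summxE; apply: eq_bigr => r _.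
rewrite mulmx_sumr mulmx_suml summxE; apply: eq_bigr => d _.
rewrite mxE fischer_sumr; apply: eq_bigr => b _.
rewrite fischer_suml mulrC [X in _ * X = _]mxE; congr (_ * _).
by apply: eq_bigr => c _; rewrite adjmxE; congr (_ * _); rewrite mxE.
Qed.

(** If the form vanishes at v then the polynomials P v are zero, and so is their
value v at the identity. *)
Lemma fischer_gram_gt0 (v : 'cV[C]_N) : v != 0 -> 0 < (v^t* *m M *m v) 0 0.
Proof.
move=> vn0; rewrite fischer_gram_form lt_neqAle eq_sym; apply/andP; split; last first.
  by apply: sumr_ge0 => r _; apply: sumr_ge0 => d _; apply: fischer_ge0.
apply: contra vn0; rewrite psumr_eq0 => [/allP v0|r _]; last first.
  by apply: sumr_ge0 => d _; apply: fischer_ge0.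
have p0 r : \sum_b v b 0 *: P r b = 0.
  apply: (@fischer_eq0 _ _ D) => [m mD|d dD].
    rewrite raddf_sum /= big1 // => b _; rewrite mpoly.mcoeffZ.
    rewrite (mdeg_ltE (leqnn _)) ?mulr0 //.
    apply: leq_trans mD; rewrite /D; apply: (@bigop.bigmax_sup _ r) => //.
    exact: (@leq_bigmax _ (fun l => mpoly.mmeasure _ (P r l)) b).
  have := v0 r (mem_index_enum _); rewrite psumr_eq0 => [|e _]; last exact: fischer_ge0.
  by move=> /allP/(_ (Ordinal dD) (mem_index_enum _))/eqP.
have : pev 1%:M *m v = 0.
  apply/matrixP => r c; rewrite [RHS]mxE mxE ord1.
  transitivity (@mxeval C n 1%:M 0); last exact: mpoly.meval0.
  by rewrite -(p0 r) mxeval_sum; apply: eq_bigr => b _; rewrite mxevalZ mxE mulrC.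
by rewrite pev1 mul1mx => ->.
Qed.

(** W is the spectral inverse square root of M.  It commutes with all that commutes
with M, in particular with the representation on the unitary group, hence
everywhere by the unitary trick. *)
Lemma fischer_gram_invsqrt : exists W : 'M[C]_N,
  W^t* *m M *m W = 1%:M /\ forall A, W *m pev A = pev A *m W.
Proof.
have Mh : M \is hermsymmx.
  by apply/is_hermitianmxP; rewrite expr0 scale1r fischer_gram_herm.
have /hermitian_normalmx/orthomx_spectralP := Mh.
set V := spectralmx M; set X := spectral_diag M.
have Vu : V \is unitarymx by apply: spectral_unitarymx.
have VV := unitarymxP Vu.
rewrite invmx_unitary // => MV.
have VMV : V *m M *m V^t* = diag_mx X.
  by rewrite MV !mulmxA VV mul1mx -mulmxA VV mulmx1.
have X0 i : 0 < X 0 i.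
  have -> : X 0 i = (V *m M *m V^t*) i i by rewrite VMV mxE eqxx.
  have := @fischer_gram_gt0 ((row i V)^t*); rewrite trmxCK.
  have -> : (row i V *m M *m (row i V)^t*) 0 0 = (V *m M *m V^t*) i i.
    by rewrite [RHS]mulmx_adj_rowE row_mul.
  apply; apply: contra_neq (oner_neq0 C) => Vi0.
  have /matrixP/(_ i i) := VV; rewrite mulmx_adj_rowE Vi0 mulmx0.
  by rewrite [in RHS]mxE eqxx mxE.
pose e : 'rV_N := \row_i (sqrtC (X 0 i))^-1.
have ee : (diag_mx e)^t* = diag_mx e.
  rewrite tr_diag_mx map_diag_mx; congr diag_mx; apply/rowP => i.
  rewrite !mxE fmorphV; congr (_^-1); apply: CrealP.
  by rewrite ger0_real ?sqrtC_ge0 // ltW.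
have eXe : diag_mx e *m diag_mx X *m diag_mx e = 1%:M.
  rewrite !mulmx_diag -diag_const_mx; congr diag_mx; apply/rowP => i.
  rewrite !mxE -[X in _ * X * _](sqrtCK (X 0 i)) expr2.
  by field; rewrite sqrtC_eq0 gt_eqF.
exists (V^t* *m diag_mx e *m V).
have WU u : u \is unitarymx ->
    (V^t* *m diag_mx e *m V) *m pev u = pev u *m (V^t* *m diag_mx e *m V).
  move=> uU; have c := fischer_gram_comm_unitary uU.
  have [R RE] : exists R, R = V *m pev u *m V^t* by eexists.
  have XR : diag_mx X *m R = R *m diag_mx X.
    by rewrite RE -VMV !mulmxA !(mulmxKtV _ Vu) // -(mulmxA V M) c mulmxA.
  have eR : diag_mx e *m R = R *m diag_mx e.
    by apply: diag_mx_comm_fun XR => i j XE; rewrite !mxE XE.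
  have -> : pev u = V^t* *m R *m V.
    by rewrite RE !mulmxA mulmxKtV // unitarymx_mulVl // mul1mx.
  by rewrite !mulmxA !(mulmxtVK _ Vu) -(mulmxA _ _ R) eR mulmxA.
split.
  rewrite !adjmx_mul trmxCK ee !mulmxA.
  transitivity (V^t* *m (diag_mx e *m (V *m M *m V^t*) *m diag_mx e) *m V).
    by rewrite !mulmxA.
  by rewrite VMV eXe mulmx1 unitarymx_mulVl.
move=> A; apply/matrixP => k l; apply/eqP; rewrite -subr_eq0; apply/eqP; move: A.
apply: line_poly_unitary_eq0 => [|u uU]; last by rewrite WU // subrr.
apply: line_polyB.
  by apply: line_poly_mulmx => *; [apply: line_poly_const|apply: line_poly_pev].
by apply: line_poly_mulmx => *; [apply: line_poly_pev|apply: line_poly_const].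
Qed.

Lemma agler_pev : agler id (fun A B => 1%:M - (pev A)^t* *m pev B).
Proof.
have [W [WMW Wc]] := fischer_gram_invsqrt.
have := agler_conj (fun=> W) agler_fischer_gram; apply: eq_agler => A B.
rewrite mulmxBr mulmxBl WMW; congr (_ - _).
rewrite !mulmxA -adjmx_mul -(mulmxA _ _ W) -!Wc adjmx_mul.
by rewrite mulmxA -(mulmxA _ _ M) -(mulmxA _ _ W) WMW mulmx1.
Qed.
End PolynomialRepresentation.

(** * The operator norm and the main theorem *)

Section OperatorNorm.
Variables (R : realType) (n : nat).
Implicit Types (v : 'cV[R[i]]_n) (z : 'M[R[i]]_n).

Lemma sqnorm_enorm v : sqnorm v = ((enorm v) ^+ 2)%:C.
Proof.
rewrite sqnormE /enorm sqr_sqrtr; last by apply: sumr_ge0 => k _; apply: sqr_ge0.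
rewrite rmorph_sum; apply: eq_bigr => k _.
by rewrite rmorphXn.
Qed.

Lemma enormZ (c : R) v : 0 <= c -> enorm (c%:C *: v) = c * enorm v.
Proof.
move=> c0; rewrite /enorm -[in RHS](ger0_norm c0) -sqrtr_sqr -sqrtrM ?sqr_ge0 //.
congr Num.sqrt; rewrite mulr_sumr; apply: eq_bigr => k _.
rewrite mxE Normc.normcM exprMn; congr (_ * _).
by rewrite /= expr0n addr0 sqr_sqrtr ?sqr_ge0.
Qed.

Lemma enorm_ge0 v : 0 <= enorm v.
Proof. exact: sqrtr_ge0. Qed.

Lemma enorm_le v (b : 'I_n -> R) : (forall k, Normc.normc (v k 0) <= b k) ->
  enorm v <= Num.sqrt (\sum_k b k ^+ 2).
Proof.
move=> vb; apply: ler_wsqrtr; apply: ler_sum => k _.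
have v0 : 0 <= Normc.normc (v k 0) by case: (v k 0) => x y; apply: sqrtr_ge0.
by rewrite ler_sqr // nnegrE // (le_trans v0).
Qed.

Lemma normc_le_enorm v k : Normc.normc (v k 0) <= enorm v.
Proof.
have v0 : 0 <= Normc.normc (v k 0) by case: (v k 0) => x y; apply: sqrtr_ge0.
rewrite -(ger0_norm v0) -sqrtr_sqr; apply: ler_wsqrtr.
by rewrite (bigD1 k) //= lerDl; apply: sumr_ge0 => l _; apply: sqr_ge0.
Qed.

(** Boundedness is what makes the supremum that defines the operator norm an
actual upper bound, since the supremum of an unbounded set is a default value. *)
Lemma enorm_mulmx_bounded z :
  has_ubound [set enorm (z *m v) | v in [set v : 'cV[R[i]]_n | enorm v <= 1]].
Proof.
exists (Num.sqrt (\sum_i (\sum_k Normc.normc (z i k)) ^+ 2)) => _ [v /= v1 <-].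
apply: enorm_le => i; rewrite mxE -lecR.
have nE (x : R[i]) : (Normc.normc x)%:C = `|x| by [].
rewrite nE; apply: le_trans (ler_norm_sum _ _ _) _.
rewrite rmorph_sum; apply: ler_sum => k _ /=.
rewrite normrM ler_piMr //.
by rewrite -[X in _ <= X]/(1%:C) lecR; apply: le_trans v1; apply: normc_le_enorm.
Qed.

Lemma openB_strict_contraction z : openB z -> strict_contraction z.
Proof.
move=> z1 v vn0.
have v0 : 0 < enorm v.
  rewrite lt_neqAle enorm_ge0 andbT eq_sym; apply: contra vn0 => /eqP v0.
  apply/eqP/adjmx_inj; rewrite trmx0 map_mx0; apply: mulmx_adj_eq0.
  apply/matrixP => i k; rewrite !ord1 trmxCK -/(sqnorm v) sqnorm_enorm v0.
  by rewrite expr0n mxE.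
pose w := ((enorm v)^-1)%:C *: v.
have w1 : enorm w = 1 by rewrite enormZ ?invr_ge0 ?enorm_ge0 // mulVf // gt_eqF.
have : enorm (z *m w) < 1.
  apply: le_lt_trans z1; apply: sup_upper_bound.
    split; last exact: enorm_mulmx_bounded.
    by exists (enorm (z *m w)), w => //=; rewrite w1.
  by exists w => //=; rewrite w1.
rewrite -scalemxAr enormZ ?invr_ge0 ?enorm_ge0 // mulrC ltr_pdivrMr // mul1r => lt.
by rewrite !sqnorm_enorm ltcR ltr_pXn2r // nnegrE enorm_ge0.
Qed.
End OperatorNorm.

Theorem theorem1p6 (R : realType) (m alpha N : nat)
    (m_gt0 : (0 < m)%N) (alpha_gt0 : (0 < alpha)%N)
    (rho : 'M[R[i]]_alpha -> 'M[R[i]]_N)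
    (rho_rep : unitary_rep rho)
    (P : 'M[mpoly.mpoly (alpha * alpha) R[i]]_N)
    (rho_poly : polynomial_rep rho P)
    (F : 'M[R[i]]_m -> 'M[R[i]]_alpha) (F_char : Char F) :
  Char (fun S => poly_eval P (F S)).
Proof.
have [rho1 rhoM rhoU _] := rho_rep.
have [sigma [_ sigma_rho sigmaP]] := rho_poly.
have PE (u : 'M[R[i]]_alpha) : u \is unitarymx -> pev P u = rho u.
  by move=> uU; rewrite -sigma_rho // sigmaP // unitarymx_unit.
have U1 : (1%:M : 'M[R[i]]_alpha) \is unitarymx.
  by apply/unitarymxP; rewrite mul1mx trmx1 map_mx1.
have P1 : pev P 1%:M = 1%:M by rewrite PE.
have PU : {in unitarymx, forall u, pev P u \is unitarymx}.
  by move=> u uU; rewrite PE // rhoU.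
have PM : {in unitarymx &, forall u v, pev P (u *m v) = pev P u *m pev P v}.
  by move=> u v uU vU; rewrite (PE u) // (PE v) // PE ?mul_unitarymx // rhoM.
have [j [g gU FE]] := F_char.
pose Z (S : {S : 'M[R[i]]_m | openB S}) := sval S.
have Zlt S : strict_contraction (Z S) by apply: openB_strict_contraction; apply: svalP.
have aF : agler Z (fun S T => 1%:M - (F (Z S))^t* *m F (Z T)).
  apply: eq_agler (transfer_agler gU Zlt) => S T /=.
  by rewrite !FE //; apply: svalP.
have aP := agler_trans aF (agler_comp (F \o Z) (agler_pev P1 PU PM)).
have [k [h hU hE]] := agler_transfer (F := fun S => pev P (F (Z S))) Zlt aP.
exists k, h => // S BS; exact: (hE (exist _ S BS)).
Qed.
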